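(* (1) For every game structure $G$ and all states $s,t$: $[s\preceq_1 t]=[t\preceq_2 s]$, and $[\simeq_1]=[\simeq_2]$. (2) There exist a game structure $G$ and states $s,t$ of $G$ with $[s\sqsubseteq_1 t]\ne[t\sqsubseteq_2 s]$. (3) There exist a game structure $G$ and states $s,t$ of $G$ with $[s\cong_1 t]\ne[s\cong_2 t]$.
   Context: A game structure $G=(S,[\cdot],\mathit{Moves},\Gamma_1,\Gamma_2,\delta)$: finite state set $S$; finite set $V$ of observation variables, each $v$ interpreted as $[v]:S\to[0,1]$; finite move set; $\Gamma_1,\Gamma_2:S\to2^{\mathit{Moves}}\setminus\{\emptyset\}$; $\delta:S\times\mathit{Moves}\times\mathit{Moves}\to\mathrm{Distr}(S)$. For player $i$, $\bar i=3-i$. Mixed moves $\mathcal{D}_i(s)=\mathrm{Distr}(\Gamma_i(s))$; $\delta(s,x_1,x_2)(u)=\sum_{a_1,a_2}\delta(s,a_1,a_2)(u)x_1(a_1)x_2(a_2)$, $x_j$ being player $j$'s mixed move. Valuations $k:S\to[0,1]$; $\mathrm{E}^{x_1,x_2}_s(k)=\sum_u\delta(s,x_1,x_2)(u)k(u)$; $\mathrm{Pre}_i(k)(s)=\sup_{x_i\in\mathcal{D}_i(s)}\inf_{x_{\bar i}\in\mathcal{D}_{\bar i}(s)}\mathrm{E}^{x_1,x_2}_s(k)$. Directed metrics: $d:S\times S\to\mathbb{R}_{\ge0}$, $d(s,s)=0$, triangle inequality; ordered pointwise; $\breve d(s,t)=d(t,s)$; $\sqcup=\max$. $C(d)=\{k:k(s)-k(t)\le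 d(s,t)\ \forall s,t\}$; $[s\equiv t]=\max_{v}|[v](s)-[v](t)|$. $H_{\preceq_i}(d)(s,t)=[s\equiv t]\sqcup\sup_{k\in C(d)}(\mathrm{Pre}_i(k)(s)-\mathrm{Pre}_i(k)(t))$; $H_{\sqsubseteq_i}(d)(s,t)=[s\equiv t]\sqcup\sup_{x_i\in\mathcal{D}_i(s)}\inf_{y_i\in\mathcal{D}_i(t)}\sup_{y_{\bar i}\in\mathcal{D}_{\bar i}(t)}\inf_{x_{\bar i}\in\mathcal{D}_{\bar i}(s)}\sup_{k\in C(d)}(\mathrm{E}^{x_1,x_2}_s(k)-\mathrm{E}^{y_1,y_2}_t(k))$. $[\preceq_i]$ = least fixpoint of $H_{\preceq_i}$ (a priori simulation metric), $[\simeq_i]$ = least symmetrical fixpoint of $H_{\preceq_i}$, i.e. least fixpoint of $d\mapsto H_{\preceq_i}(d)\sqcup\breve{H_{\preceq_i}(d)}$ (a priori bisimulation metric); $[\sqsubseteq_i]$ and $[\cong_i]$ are defined likewise from $H_{\sqsubseteq_i}$ (a posteriori metrics). Fixpoints are in the lattice of directed metrics. $[s\preceq_i t]$ denotes $[\preceq_i](s,t)$, etc. *)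

(* Defs.v *)
From mathcomp Require Import all_boot all_order all_algebra.
From mathcomp Require Import all_classical reals.
From mathcomp Require Import ring lra.

Set Implicit Arguments.
Unset Strict Implicit.
Unset Printing Implicit Defensive.

Import Order.TTheory GRing.Theory Num.Theory.

Local Open Scope classical_set_scope.
Local Open Scope ring_scope.

Definition is_distr (R : realType) (T : finType) (p : T -> R) : Prop :=
  (forall a, 0 <= p a) /\ \sum_(a : T) p a = 1.

Inductive player := P1 | P2.

Definition opponent (i : player) : player :=
  match i with P1 => P2 | P2 => P1 end.

Record game_structure (R : realType) := GameStructure {
  state : finType;
  obs : finType;
  interp : obs -> state -> R;
  interp_itv : forall v s, 0 <= interp v s <= 1;
  move : finType;
  Gam : player -> state -> {set move};
  Gam_neq0 : forall i s, Gam i s != finset.set0;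
  delta : state -> move -> move -> state -> R;
  delta_distr : forall s a1 a2, is_distr (delta s a1 a2)
}.

Section Game.
Context {R : realType} (G : game_structure R).

Local Notation S := (state G).
Local Notation M := (move G).

(* Distr(Gam i s), as distributions over all moves vanishing outside Gam i s *)
Definition mixed (i : player) (s : S) : set (M -> R) :=
  [set x | is_distr x /\ forall a, a \notin Gam i s -> x a = 0].

Definition delta_mixed (s : S) (x1 x2 : M -> R) (u : S) : R :=
  \sum_(a1 : M) \sum_(a2 : M) delta s a1 a2 u * x1 a1 * x2 a2.

Definition expect (s : S) (x1 x2 : M -> R) (k : S -> R) : R :=
  \sum_(u : S) delta_mixed s x1 x2 u * k u.

(* E_s^{x_1,x_2}(k), with x the mixed move of player i and xo the opponent's *)
Definition expect_for (i : player) (s : S) (x xo : M -> R) (k : S -> R) : R :=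
  match i with P1 => expect s x xo k | P2 => expect s xo x k end.

Definition Pre (i : player) (k : S -> R) (s : S) : R :=
  sup [set inf [set expect_for i s x xo k | xo in mixed (opponent i) s]
      | x in mixed i s].

Definition valuation (k : S -> R) : Prop := forall s, 0 <= k s <= 1.

Definition directed_metric (d : S -> S -> R) : Prop :=
  [/\ forall s t, 0 <= d s t,
      forall s, d s s = 0
    & forall s t u, d s u <= d s t + d t u].

Definition dle (d d' : S -> S -> R) : Prop := forall s t, d s t <= d' s t.

Definition dconv (d : S -> S -> R) : S -> S -> R := fun s t => d t s.

Definition djoin (d d' : S -> S -> R) : S -> S -> R :=
  fun s t => Num.max (d s t) (d' s t).

Definition Cval (d : S -> S -> R) : set (S -> R) :=
  [set k | valuation k /\ forall s t, k s - k t <= d s t].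

Definition obs_dist (s t : S) : R :=
  \big[Num.max/0]_(v : obs G) `|interp v s - interp v t|.

Definition H_prio (i : player) (d : S -> S -> R) : S -> S -> R := fun s t =>
  Num.max (obs_dist s t) (sup [set Pre i k s - Pre i k t | k in Cval d]).

Definition H_post (i : player) (d : S -> S -> R) : S -> S -> R := fun s t =>
  Num.max (obs_dist s t)
    (sup [set inf [set sup [set inf [set
       sup [set expect_for i s x xo k - expect_for i t y yo k | k in Cval d]
     | xo in mixed (opponent i) s]
     | yo in mixed (opponent i) t]
     | y in mixed i t]
     | x in mixed i s]).

Definition symmetrize (F : (S -> S -> R) -> (S -> S -> R)) :
    (S -> S -> R) -> (S -> S -> R) :=
  fun d => djoin (F d) (dconv (F d)).

Definition is_lfp (F : (S -> S -> R) -> (S -> S -> R)) (d : S -> S -> R) : Prop :=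
  [/\ directed_metric d, F d = d
    & forall d', directed_metric d' -> F d' = d' -> dle d d'].

(* The default value of [xget] is never used for the four operators below:
   see [is_lfp_sim_prio], ..., [is_lfp_bisim_post]. *)
Definition lfp (F : (S -> S -> R) -> (S -> S -> R)) : S -> S -> R :=
  xget (fun _ _ => 0) [set d | is_lfp F d].

Definition sim_prio (i : player) : S -> S -> R := lfp (H_prio i).

Definition bisim_prio (i : player) : S -> S -> R := lfp (symmetrize (H_prio i)).

Definition sim_post (i : player) : S -> S -> R := lfp (H_post i).

Definition bisim_post (i : player) : S -> S -> R := lfp (symmetrize (H_post i)).

End Game.

Section SupInf.
Context {R : realType} {T : Type}.
Implicit Types (A : set T) (f g : T -> R).

Definition bnd1 A f := forall a, A a -> -1 <= f a <= 1.

Lemma img_le_sup A f a : bnd1 A f -> A a -> f a <= sup [set f a | a in A].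
Proof.
move=> b Aa; apply: ub_le_sup; last by exists a.
by exists 1 => _ [c Ac <-]; have /andP[] := b _ Ac.
Qed.

Lemma inf_le_img A f a : bnd1 A f -> A a -> inf [set f a | a in A] <= f a.
Proof.
move=> b Aa; apply: ge_inf; last by exists a.
by exists (-1) => _ [c Ac <-]; have /andP[] := b _ Ac.
Qed.

Lemma sup_img_le A f c :
  A !=set0 -> (forall a, A a -> f a <= c) -> sup [set f a | a in A] <= c.
Proof.
move=> [a Aa] h; apply: ge_sup; first by exists (f a), a.
by move=> _ [e Ae <-]; exact: h.
Qed.

Lemma inf_img_adherent A f e : A !=set0 -> bnd1 A f -> 0 < e ->
  exists2 a, A a & f a < inf [set f a | a in A] + e.
Proof.
move=> [a Aa] b e0.
have [|_ [c Ac <-] h] := @inf_adherent _ [set f a | a in A] e e0.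
  split; first by exists (f a), a.
  by exists (-1) => _ [c Ac <-]; have /andP[] := b _ Ac.
by exists c.
Qed.

Lemma bnd1_sup A f : A !=set0 -> bnd1 A f -> -1 <= sup [set f a | a in A] <= 1.
Proof.
move=> [a Aa] b; apply/andP; split.
  by apply: le_trans (img_le_sup b Aa); have /andP[] := b _ Aa.
by apply: sup_img_le => [|c Ac]; [exists a|have /andP[] := b _ Ac].
Qed.

Lemma bnd1_inf A f : A !=set0 -> bnd1 A f -> -1 <= inf [set f a | a in A] <= 1.
Proof.
move=> [a Aa] b; apply/andP; split; last first.
  by apply: le_trans (inf_le_img b Aa) _; have /andP[] := b _ Aa.
apply: lb_le_inf => [|_ [c Ac <-]]; first by exists (f a), a.
by have /andP[] := b _ Ac.
Qed.

Lemma le_sup_img A B f g : A !=set0 -> A `<=` B -> bnd1 B g ->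
  (forall a, A a -> f a <= g a) ->
  sup [set f a | a in A] <= sup [set g a | a in B].
Proof.
move=> A0 AB b h; apply: sup_img_le => // a Aa.
exact: le_trans (h _ Aa) (img_le_sup b (AB _ Aa)).
Qed.

Lemma le_inf_img A f g : A !=set0 -> bnd1 A f ->
  (forall a, A a -> f a <= g a) ->
  inf [set f a | a in A] <= inf [set g a | a in A].
Proof.
move=> [a Aa] b h; apply: lb_le_inf => [|_ [c Ac <-]]; first by exists (g a), a.
exact: le_trans (inf_le_img b Ac) (h _ Ac).
Qed.

End SupInf.

Lemma eps4_chain (R : realType) (l4 l4' l3 l3' l2 l2' l1 l1' k k' a b c e : R) :
  l3 <= l4 -> l3' <= l4' -> l2 < l3 + e / 4 -> l2' < l3' + e / 4 ->
  l1' <= l2' -> l1 <= l2 -> k' < l1' + e / 4 -> k < l1 + e / 4 ->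
  a - b <= k -> b - c <= k' -> a - c <= l4 + l4' + e.
Proof. lra. Qed.

Section Existence.
Context {R : realType} (G : game_structure R).

Local Notation S := (state G).
Local Notation M := (move G).
Implicit Types (d : S -> S -> R) (k : S -> R) (i : player).

Lemma mixed_neq0 i (s : S) : mixed i s !=set0.
Proof.
have /set0Pn[a0 a0P] := Gam_neq0 i s.
exists (fun a => (a == a0)%:R); split; first split=> [a|].
- exact: ler0n.
- by rewrite (bigD1 a0)//= eqxx big1 ?addr0 // => a /negbTE ->.
- by move=> a aN; case: eqP => // aE; rewrite aE a0P in aN.
Qed.

Lemma delta_mixed_distr i j (s : S) (x1 x2 : M -> R) :
  mixed i s x1 -> mixed j s x2 -> is_distr (delta_mixed s x1 x2).
Proof.
move=> [[x1p x1s] _] [[x2p x2s] _]; split=> [u|].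
  rewrite /delta_mixed; apply: sumr_ge0 => a _; apply: sumr_ge0 => b _.
  by rewrite !mulr_ge0 //; have [] := delta_distr s a b.
rewrite /delta_mixed exchange_big /= -x1s; apply: eq_bigr => a _.
rewrite exchange_big /= -[RHS]mulr1 -x2s mulr_sumr; apply: eq_bigr => b _.
by rewrite -!mulr_suml (delta_distr s a b).2 mul1r.
Qed.

Lemma expect_for_itv i (s : S) (x xo : M -> R) k :
  mixed i s x -> mixed (opponent i) s xo -> valuation k ->
  0 <= expect_for i s x xo k <= 1.
Proof.
suff h p : is_distr p -> valuation k -> 0 <= \sum_(u : S) p u * k u <= 1.
  by move=> mx mxo vk; case: i mx mxo => mx mxo; apply: h => //;
     apply: delta_mixed_distr; eassumption.
move=> [p0 p1] vk; apply/andP; split.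
  by apply: sumr_ge0 => u _; rewrite mulr_ge0 //; have /andP[] := vk u.
rewrite -p1; apply: ler_sum => u _; apply: ler_piMr => //.
by have /andP[] := vk u.
Qed.

Lemma Pre_itv i k (s : S) : valuation k -> 0 <= Pre i k s <= 1.
Proof.
move=> vk; have b x : mixed i s x ->
    bnd1 (mixed (opponent i) s) (fun xo => expect_for i s x xo k).
  by move=> mx xo mxo; have := expect_for_itv mx mxo vk; lra.
have b' : bnd1 (mixed i s)
    (fun x => inf [set expect_for i s x xo k | xo in mixed (opponent i) s]).
  by move=> x mx; exact: bnd1_inf (mixed_neq0 _ _) (b _ mx).
have /andP[_ h1] := bnd1_sup (mixed_neq0 i s) b'.
rewrite /Pre h1 andbT.
have [x mx] := mixed_neq0 i s; apply: le_trans (img_le_sup b' mx).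
have [xo mxo] := mixed_neq0 (opponent i) s.
apply: lb_le_inf => [|_ [yo myo <-]]; first by eexists; exists xo.
by have /andP[] := expect_for_itv mx myo vk.
Qed.

Lemma Cval_const d : directed_metric d -> Cval d (fun=> 0).
Proof. by move=> [d0 _ _]; split=> [s|s t]; rewrite ?subrr // lexx ler01. Qed.

Lemma Cval_neq0 d : directed_metric d -> Cval d !=set0.
Proof. by move=> /Cval_const; exists (fun=> 0). Qed.

Lemma le_Cval d d' : dle d d' -> Cval d `<=` Cval d'.
Proof. by move=> dd' k [vk kd]; split=> // s t; exact: le_trans (dd' s t). Qed.

Lemma obs_dist_ge0 (s t : S) : 0 <= obs_dist s t.
Proof. exact: bigmax_ge_id. Qed.

Lemma obs_dist_le1 (s t : S) : obs_dist s t <= 1.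
Proof.
apply: bigmax_le => // v _; rewrite ler_norml.
by have := interp_itv v s; have := interp_itv v t; lra.
Qed.

Lemma obs_dist_refl (s : S) : obs_dist s s = 0.
Proof.
apply/le_anti; rewrite obs_dist_ge0 andbT.
by apply: bigmax_le => // v _; rewrite subrr normr0.
Qed.

Lemma obs_dist_triangle (s t u : S) :
  obs_dist s u <= obs_dist s t + obs_dist t u.
Proof.
apply: bigmax_le => [|v _]; first by rewrite addr_ge0 ?obs_dist_ge0.
apply: le_trans (ler_distD (interp v t) _ _) _.
by apply: lerD; apply: (le_bigmax _ (fun v => `|interp v _ - interp v _|)).
Qed.

Lemma directed_metric_join_obs (f : S -> S -> R) :
  (forall s, f s s <= 0) -> (forall s t u, f s u <= f s t + f t u) ->
  directed_metric (fun s t => Num.max (obs_dist s t) (f s t)).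
Proof.
move=> f0 ft; split=> [s t|s|s t u].
- by rewrite le_max obs_dist_ge0.
- by rewrite obs_dist_refl; apply/max_idPl.
- rewrite ge_max; apply/andP; split.
    apply: le_trans (obs_dist_triangle s t u) _.
    by apply: lerD; rewrite le_max lexx.
  by apply: le_trans (ft s t u) _; apply: lerD; rewrite le_max lexx orbT.
Qed.

Definition admissible (F : (S -> S -> R) -> (S -> S -> R)) : Prop :=
  [/\ forall d, directed_metric d -> directed_metric (F d),
      forall d, directed_metric d -> forall s t, F d s t <= 1
    & forall d d', directed_metric d -> directed_metric d' ->
        dle d d' -> dle (F d) (F d')].

Lemma admissible_symmetrize F : admissible F -> admissible (symmetrize F).
Proof.
move=> [Fd F1 Fm]; split=> [d dd|d dd s t|d d' dd dd' le s t].
- have [h0 hr ht] := Fd _ dd; split=> [s t|s|s t u];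
    rewrite /symmetrize /djoin /dconv.
  + by rewrite le_max h0.
  + by rewrite !hr maxxx.
  + rewrite ge_max; apply/andP; split.
      by apply: le_trans (ht s t u) _; apply: lerD; rewrite le_max lexx.
    apply: le_trans (ht u t s) _; rewrite addrC.
    by apply: lerD; rewrite le_max lexx orbT.
- by rewrite /symmetrize /djoin /dconv ge_max !F1.
- by rewrite /symmetrize /djoin /dconv ge_max !le_max !Fm ?orbT.
Qed.

Lemma bnd1_Pre d i (s t : S) :
  bnd1 (Cval d) (fun k => Pre i k s - Pre i k t).
Proof.
by move=> k [vk _]; have := Pre_itv i s vk; have := Pre_itv i t vk; lra.
Qed.

Lemma admissible_H_prio i : admissible (@H_prio R G i).
Proof.
split=> [d dd|d dd s t|d d' dd dd' le s t].
- apply: directed_metric_join_obs => [s|s t u].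
    by apply: sup_img_le => [|k _]; [exact: Cval_neq0|rewrite subrr].
  apply: sup_img_le => [|k kd]; first exact: Cval_neq0.
  have h1 := img_le_sup (bnd1_Pre (d := d) i s t) kd.
  have h2 := img_le_sup (bnd1_Pre (d := d) i t u) kd.
  by rewrite /= in h1 h2; lra.
- rewrite /H_prio ge_max obs_dist_le1 /=.
  by have /andP[] := bnd1_sup (Cval_neq0 dd) (bnd1_Pre (d := d) i s t).
- rewrite /H_prio ge_max !le_max lexx /=; apply/orP; right.
  apply: le_sup_img => //; [exact: Cval_neq0|exact: le_Cval|exact: bnd1_Pre].
Qed.

Section Post.
Context (i : player).

Let K d s t x y yo xo :=
  sup [set expect_for i s x xo k - expect_for i t y yo k | k in Cval d].
Let L1 d s t x y yo := inf [set K d s t x y yo xo | xo in mixed (opponent i) s].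
Let L2 d s t x y := sup [set L1 d s t x y yo | yo in mixed (opponent i) t].
Let L3 d s t x := inf [set L2 d s t x y | y in mixed i t].
Let L4 d s t := sup [set L3 d s t x | x in mixed i s].

Let bE d s t x y yo xo : mixed i s x -> mixed i t y ->
  mixed (opponent i) t yo -> mixed (opponent i) s xo ->
  bnd1 (Cval d) (fun k => expect_for i s x xo k - expect_for i t y yo k).
Proof.
move=> mx my myo mxo k [vk _].
by have := expect_for_itv mx mxo vk; have := expect_for_itv my myo vk; lra.
Qed.

Let bK d s t x y yo : directed_metric d -> mixed i s x -> mixed i t y ->
  mixed (opponent i) t yo -> bnd1 (mixed (opponent i) s) (K d s t x y yo).
Proof.
by move=> dd mx my myo xo mxo; exact: bnd1_sup (Cval_neq0 dd) (bE mx my myo mxo).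
Qed.

Let b1 d s t x y : directed_metric d -> mixed i s x -> mixed i t y ->
  bnd1 (mixed (opponent i) t) (L1 d s t x y).
Proof.
by move=> dd mx my yo myo; exact: bnd1_inf (mixed_neq0 _ _) (bK dd mx my myo).
Qed.

Let b2 d s t x : directed_metric d -> mixed i s x ->
  bnd1 (mixed i t) (L2 d s t x).
Proof.
by move=> dd mx y my; exact: bnd1_sup (mixed_neq0 _ _) (b1 dd mx my).
Qed.

Let b3 d s t : directed_metric d -> bnd1 (mixed i s) (L3 d s t).
Proof. by move=> dd x mx; exact: bnd1_inf (mixed_neq0 _ _) (b2 dd mx). Qed.

Let L4_refl d s : directed_metric d -> L4 d s s <= 0.
Proof.
move=> dd; apply: sup_img_le => [|x mx]; first exact: mixed_neq0.
apply: le_trans (inf_le_img (b2 dd mx) mx) _.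
apply: sup_img_le => [|yo myo]; first exact: mixed_neq0.
apply: le_trans (inf_le_img (bK dd mx mx myo) myo) _.
by apply: sup_img_le => [|k _]; [exact: Cval_neq0|rewrite subrr].
Qed.

Let L4_triangle d s t u : directed_metric d ->
  L4 d s u <= L4 d s t + L4 d t u.
Proof.
move=> dd; apply/ler_addgt0Pr => e e0.
have e4 : 0 < e / 4 by lra.
apply: sup_img_le => [|x mx]; first exact: mixed_neq0.
have [y my hy] := inf_img_adherent (mixed_neq0 i t) (b2 dd mx) e4.
have [z mz hz] := inf_img_adherent (mixed_neq0 i u) (b2 dd my) e4.
have h1 : L3 d s t x <= L4 d s t := img_le_sup (b3 _ dd) mx.
have h2 : L3 d t u y <= L4 d t u := img_le_sup (b3 _ dd) my.
have h3 : L2 d s t x y < L3 d s t x + e / 4 := hy.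
have h4 : L2 d t u y z < L3 d t u y + e / 4 := hz.
apply: le_trans (inf_le_img (b2 dd mx) mz) _.
apply: sup_img_le => [|zo mzo]; first exact: mixed_neq0.
have [yo myo hyo] := inf_img_adherent (mixed_neq0 _ _) (bK dd my mz mzo) e4.
have [xo mxo hxo] := inf_img_adherent (mixed_neq0 _ _) (bK dd mx my myo) e4.
have h5 : L1 d t u y z zo <= L2 d t u y z := img_le_sup (b1 dd my mz) mzo.
have h6 : L1 d s t x y yo <= L2 d s t x y := img_le_sup (b1 dd mx my) myo.
have h7 : K d t u y z zo yo < L1 d t u y z zo + e / 4 := hyo.
have h8 : K d s t x y yo xo < L1 d s t x y yo + e / 4 := hxo.
apply: le_trans (inf_le_img (bK dd mx mz mzo) mxo) _.
apply: sup_img_le => [|k kd]; first exact: Cval_neq0.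
have h9 : _ <= K d s t x y yo xo := img_le_sup (bE mx my myo mxo) kd.
have h10 : _ <= K d t u y z zo yo := img_le_sup (bE my mz mzo myo) kd.
exact: eps4_chain h1 h2 h3 h4 h5 h6 h7 h8 h9 h10.
Qed.

Lemma admissible_H_post : admissible (@H_post R G i).
Proof.
split=> [d dd|d dd s t|d d' dd dd' le s t].
- by apply: directed_metric_join_obs => [s|s t u];
    [exact: L4_refl|exact: L4_triangle].
- rewrite /H_post ge_max obs_dist_le1 /=.
  by have /andP[] := bnd1_sup (mixed_neq0 i s) (@b3 d s t dd).
- rewrite /H_post ge_max !le_max lexx /=; apply/orP; right.
  apply: le_sup_img => [||| x mx] //; [exact: mixed_neq0|exact: b3|].
  apply: le_inf_img => [||y my]; [exact: mixed_neq0|exact: b2|].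
  apply: le_sup_img => [||| yo myo] //; [exact: mixed_neq0|exact: b1|].
  apply: le_inf_img => [||xo mxo]; [exact: mixed_neq0|exact: bK|].
  by apply: le_sup_img => //; [exact: Cval_neq0|exact: le_Cval|exact: bE].
Qed.

End Post.

Lemma admissible_is_lfp F : admissible F -> is_lfp F (lfp F).
Proof.
move=> [Fd F1 Fm]; rewrite /lfp; apply: (@xgetPex _ _ [set d | is_lfp F d]).
pose top : S -> S -> R := fun s t => (s != t)%:R.
have dtop : directed_metric top.
  split=> [s t|s|s t u]; rewrite /top ?ler0n ?eqxx //.
  have [<-|st] := eqVneq s t; first by rewrite add0r.
  by case: (s != u) (t != u) => [] [] /=; lra.
have Ftop d : directed_metric d -> dle (F d) top.
  move=> dd s t; rewrite /top; have [<-|_] := eqVneq s t; last exact: F1.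
  by have [_ -> _] := Fd _ dd.
pose P := [set d | directed_metric d /\ dle (F d) d].
pose L := [set d | directed_metric d /\ forall d', P d' -> dle d d'].
have Ptop : P top by split => //; exact: Ftop.
pose m : S -> S -> R := fun s t => sup [set d s t | d in L].
have bL s t : bnd1 L (fun d => d s t).
  move=> d [[d0 _ _] dP]; apply/andP; split; first by apply: le_trans (d0 _ _); lra.
  by apply: le_trans (dP _ Ptop s t) _; rewrite /top; case: (s != t).
have L0 : L (fun _ _ => 0).
  split; first by split=> *; rewrite ?addr0.
  by move=> d' [[d0 _ _] _] s t.
have Lne : L !=set0 by exists (fun _ _ => 0).
have Lm d : L d -> dle d m by move=> Ld s t; exact: (img_le_sup (bL s t) Ld).
have mP d : P d -> dle m d.
  by move=> Pd s t; apply: sup_img_le => // d' [_ h]; exact: h.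
have dm : directed_metric m.
  split=> [s t|s|s t u].
  - exact: (Lm _ L0).
  - apply/le_anti; rewrite (Lm _ L0 s s) andbT.
    by apply: sup_img_le => // d [[_ -> _] _].
  - apply: sup_img_le => // d Ld; have [[_ _ dt] _] := Ld.
    by apply: le_trans (dt s t u) _; apply: lerD; exact: Lm.
have LFm : L (F m).
  split=> [|d Pd s t]; first exact: Fd.
  have [dd Fdd] := Pd; apply: le_trans (Fdd s t).
  by apply: Fm => //; exact: mP.
have Fmm : dle (F m) m by exact: Lm.
exists m; split=> // [|d dd Fdd].
  apply/funext => s; apply/funext => t; apply/le_anti; rewrite Fmm /=.
  apply: mP; split; first exact: Fd.
  by apply: Fm => //; exact: Fd.
by apply: mP; split=> // s t; rewrite Fdd.
Qed.

Lemma is_lfp_sim_prio i : is_lfp (H_prio i) (@sim_prio R G i).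
Proof. exact: admissible_is_lfp (admissible_H_prio i). Qed.

Lemma is_lfp_bisim_prio i : is_lfp (symmetrize (H_prio i)) (@bisim_prio R G i).
Proof. exact: admissible_is_lfp (admissible_symmetrize (admissible_H_prio i)). Qed.

Lemma is_lfp_sim_post i : is_lfp (H_post i) (@sim_post R G i).
Proof. exact: admissible_is_lfp (admissible_H_post i). Qed.

Lemma is_lfp_bisim_post i : is_lfp (symmetrize (H_post i)) (@bisim_post R G i).
Proof. exact: admissible_is_lfp (admissible_symmetrize (admissible_H_post i)). Qed.

End Existence.

(* Main.v *)
Require Import Defs.
From mathcomp Require Import all_boot all_order all_algebra.
From mathcomp Require Import all_classical reals.
From mathcomp Require Import ring lra.

Set Implicit Arguments.
Unset Strict Implicit.
Unset Printing Implicit Defensive.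

Import Order.TTheory GRing.Theory Num.Theory.

Local Open Scope classical_set_scope.
Local Open Scope ring_scope.

(** The minimax theorem gives Pre_2(1 - k) = 1 - Pre_1(k), and k |-> 1 - k
    exchanges C(d) with the C of the converse of d; hence H_prio for player 2 is
    the converse of H_prio for player 1, and so are their least fixpoints.

    A posteriori, the opponent's move is chosen before the valuation k, so the
    objective |p - q| is not concave in it and the order of quantifiers matters.
    Let s reach a goal with probability 1/2, and t with probability
    (y1 + 2 y2) / 3. Whatever y1 is, player 2 can keep t at distance 1/3 from s,
    so player 1's metrics from s to t are at least 1/3. But the answers y2 = 1/2
    (simulating s by t) and y1 = 1 - y2 (simulating t by s) keep the distance
    within 1/6, so player 2's metrics are at most 1/6. *)

(** * Approximate minimax for finite matrix games *)

Section Minimax.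
Context {R : realType} {I J : finType} (A : I -> J -> R).

(** Convertible to [mixed i s] when [P] is [Gam i s], so [minimax] applies to mixed moves
    directly. *)
Definition distr_on (T : finType) (P : {set T}) : set (T -> R) :=
  [set x | is_distr x /\ forall a, a \notin P -> x a = 0].

Definition pure_payoff (a : I) (y : J -> R) : R := \sum_b A a b * y b.

Definition payoff (x : I -> R) (y : J -> R) : R :=
  \sum_a x a * pure_payoff a y.

(** The displacement of the payoff vector of [y] from the convex set of vectors at most [c] on
    [P]. *)
Definition excess (P : {set I}) (c : R) (y : J -> R) (a : I) : R :=
  if a \in P then Num.max 0 (pure_payoff a y - c) else 0.

Lemma pure_payoff_norm (a : I) (Q : {set J}) (y : J -> R) :
  distr_on Q y -> `|pure_payoff a y| <= \sum_a' \sum_b `|A a' b|.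
Proof.
move=> [[y0 y1] _]; apply: (@le_trans _ _ (\sum_b `|A a b|)).
  apply: le_trans (ler_norm_sum _ _ _) _; apply: ler_sum => b _.
  rewrite normrM ler_piMr // ger0_norm // -y1 (bigD1 b) //= lerDl.
  by apply: sumr_ge0.
rewrite [leRHS](bigD1 a) //= lerDl.
by apply: sumr_ge0 => a' _; apply: sumr_ge0.
Qed.

Lemma distr_on_conv (T : finType) (Q : {set T}) (y y' : T -> R) (l : R) :
  0 <= l <= 1 -> distr_on Q y -> distr_on Q y' ->
  distr_on Q (fun b => l * y b + (1 - l) * y' b).
Proof.
move=> /andP[l0 l1] [[p s] z] [[p' s'] z']; split; first split=> [b|].
- by rewrite addr_ge0 // mulr_ge0 // subr_ge0.
- by rewrite big_split /= -!mulr_sumr s s'; ring.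
- by move=> b bQ; rewrite z // z' // !mulr0 addr0.
Qed.

Lemma pure_payoff_conv (a : I) (y y' : J -> R) (l : R) :
  pure_payoff a (fun b => l * y b + (1 - l) * y' b) =
  l * pure_payoff a y + (1 - l) * pure_payoff a y'.
Proof.
rewrite /pure_payoff !mulr_sumr -big_split /=.
by apply: eq_bigr => b _; ring.
Qed.

Lemma excess_ge0 P c y a : 0 <= excess P c y a.
Proof. by rewrite /excess; case: ifP => // _; rewrite le_max lexx. Qed.

(** Here [z] may have any sign: it dominates the excess where that is positive, and elsewhere the
    left side is 0. *)
Lemma excess_sqr_le P c y a (z : R) :
  pure_payoff a y - c <= z -> excess P c y a ^+ 2 <= z ^+ 2.
Proof.
move=> h; rewrite /excess; case: ifP => _; last by rewrite expr0n sqr_ge0.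
have [le0|gt0] := leP (pure_payoff a y - c) 0; first by rewrite expr0n sqr_ge0.
by rewrite ler_pXn2r // nnegrE; lra.
Qed.

Lemma distr_on_neq0 (T : finType) (Q : {set T}) :
  Q != finset.set0 -> distr_on Q !=set0.
Proof.
move=> /set0Pn[b0 b0Q]; exists (fun b => (b == b0)%:R); split; first split=> [b|].
- exact: ler0n.
- by rewrite (bigD1 b0)//= eqxx big1 ?addr0 // => b /negbTE ->.
- by move=> b bN; case: eqP => // bE; rewrite bE b0Q in bN.
Qed.

Let B (c : R) : R := \sum_a \sum_b `|A a b| + `|c|.

Let sub_norm c a Q y : distr_on Q y -> `|pure_payoff a y - c| <= B c.
Proof.
move=> Qy; apply: le_trans (ler_normB _ _) _.
by rewrite lerD2r; exact: pure_payoff_norm Qy.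
Qed.

Let sub_sqr c a Q y : distr_on Q y -> (pure_payoff a y - c) ^+ 2 <= B c ^+ 2.
Proof.
move=> /(sub_norm c a) h; rewrite -real_normK ?num_real //.
by rewrite ler_pXn2r // nnegrE //; apply: le_trans h.
Qed.

(* Blackwell's approachability argument: answering the mixed move
   proportional to the current excess makes the cross term of the squared norm
   nonpositive, so the squared norm of the averaged excess is O(1/n). *)
Lemma excess_average (P : {set I}) (Q : {set J}) (c : R) :
  Q != finset.set0 ->
  (forall x, distr_on P x -> exists2 y, distr_on Q y & payoff x y <= c) ->
  forall n, exists2 y, distr_on Q y &
    n.+1%:R * \sum_a excess P c y a ^+ 2 <= \sum_(a : I) B c ^+ 2.
Proof.
move=> Q0 resp; elim=> [|n [y Qy IH]].
  have [y Qy] := distr_on_neq0 Q0; exists y => //.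
  rewrite mul1r; apply: ler_sum => a _.
  exact: le_trans (excess_sqr_le P (lexx _)) (sub_sqr c a Qy).
pose w := excess P c y.
have w0 a : 0 <= w a by exact: excess_ge0.
pose W := \sum_a w a.
have [W0|Wn0] := eqVneq W 0.
  exists y => //; rewrite big1 ?mulr0 => [|a _].
    by apply: sumr_ge0 => a _; exact: sqr_ge0.
  by rewrite [excess _ _ _ _](psumr_eq0P _ W0) ?expr0n.
have Wgt0 : 0 < W by rewrite lt_neqAle eq_sym Wn0; apply: sumr_ge0.
have [|y' Qy' hy'] := resp (fun a => w a / W).
  split; first split=> [a|].
  - by rewrite divr_ge0 // ltW.
  - by rewrite -mulr_suml divff.
  - by move=> a /negbTE aP; rewrite /w /excess aP mul0r.
pose r a := pure_payoff a y' - c.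
have cross : \sum_a w a * r a <= 0.
  have -> : \sum_a w a * r a = W * (payoff (fun a => w a / W) y' - c).
    rewrite mulrBr /payoff mulr_sumr -/W mulr_suml -sumrB.
    apply: eq_bigr => a _; rewrite /r; field.
    exact: Wn0.
  by rewrite pmulr_rle0 // subr_le0.
have N0 : 0 < n.+2%:R :> R by rewrite ltr0n.
have NE : n.+2%:R = n.+1%:R + 1 :> R by rewrite -natr1.
have M0 : 0 <= n.+1%:R :> R by rewrite ler0n.
(* The weight of a running average: [y] counts for [n + 1] rounds, [y'] for one. *)
pose l : R := n.+1%:R / n.+2%:R.
have lE : l * n.+2%:R = n.+1%:R by rewrite /l divfK // gt_eqF.
have l1 : 0 <= l <= 1.
  by rewrite divr_ge0 //= ler_pdivrMr // mul1r NE; lra.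
exists (fun b => l * y b + (1 - l) * y' b); first exact: distr_on_conv.
set C := \sum_(a : I) B c ^+ 2 in IH *.
have step : \sum_a excess P c (fun b => l * y b + (1 - l) * y' b) a ^+ 2 <=
    l ^+ 2 * (\sum_a w a ^+ 2) + (1 - l) ^+ 2 * C
    + 2 * l * (1 - l) * \sum_a w a * r a.
  rewrite !mulr_sumr -!big_split /=; apply: ler_sum => a _.
  have [aP|aP] := boolP (a \in P); last first.
    rewrite /w /excess (negbTE aP) expr0n /= mulr0 add0r mul0r mulr0 addr0.
    by rewrite mulr_ge0 // sqr_ge0.
  (* The gap of [y] is replaced by its positive part before squaring, so that the mixed products add
     up to the sum in [cross]. *)
  apply: (@le_trans _ _ ((l * w a + (1 - l) * r a) ^+ 2)).
    apply: excess_sqr_le; rewrite pure_payoff_conv.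
    have h : pure_payoff a y - c <= w a by rewrite /w /excess aP le_max lexx orbT.
    have /andP[l0 _] := l1; have := ler_wpM2l l0 h; rewrite /r.
    by set p := pure_payoff a y'; lra.
  have h := ler_wpM2l (sqr_ge0 (1 - l)) (sub_sqr c a Qy').
  by move: h; rewrite -/(r a) => h; nra.
have cr : 2 * l * (1 - l) * (\sum_a w a * r a) <= 0.
  by apply: mulr_ge0_le0 => //; have := l1; nra.
have {cr} step := le_trans step (ler_wnDr cr (lexx _)).
(* After scaling by [(n + 2)^2] the induction hypothesis bounds the first term by [(n + 1) C], and
   the second equals [C]. *)
rewrite -(ler_pM2l N0).
apply: le_trans (ler_wpM2l (ltW N0) (ler_wpM2l (ltW N0) step)) _.
have -> : n.+2%:R * (n.+2%:R * (l ^+ 2 * \sum_a w a ^+ 2 + (1 - l) ^+ 2 * C)) =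
    (l * n.+2%:R) ^+ 2 * \sum_a w a ^+ 2 + (n.+2%:R - l * n.+2%:R) ^+ 2 * C by ring.
rewrite lE NE.
have := ler_wpM2l M0 IH; rewrite -/w.
by set m := n.+1%:R; set X := \sum_a _; lra.
Qed.

(** The slack [e] replaces a compactness argument: once [(n + 1) e^2] exceeds the bound of
    [excess_average], no row of [P] pays more than [c + e], and mixing rows preserves this. *)
Lemma minimax (P : {set I}) (Q : {set J}) (c e : R) :
  Q != finset.set0 ->
  (forall x, distr_on P x -> exists2 y, distr_on Q y & payoff x y <= c) ->
  0 < e -> exists2 y, distr_on Q y & forall x, distr_on P x -> payoff x y <= c + e.
Proof.
move=> Q0 resp e0; set C := \sum_(a : I) B c ^+ 2.
have C0 : 0 <= C by apply: sumr_ge0 => a _; exact: sqr_ge0.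
have e20 : 0 < e ^+ 2 by rewrite exprn_gt0.
have [n hn] : exists n : nat, C < n.+1%:R * e ^+ 2.
  exists (Num.truncn (C / e ^+ 2)); rewrite -ltr_pdivrMr //.
  exact: truncnS_gt.
have [y Qy hy] := excess_average Q0 resp n.
exists y => // x [[x0 x1] xP].
have pe a : a \in P -> pure_payoff a y <= c + e.
  move=> aP; rewrite leNgt; apply/negP => h.
  have ex : e ^+ 2 <= excess P c y a ^+ 2.
    rewrite ler_pXn2r // ?nnegrE ?excess_ge0 ?ltW //.
    by rewrite /excess aP lt_max; apply/orP; right; lra.
  have : n.+1%:R * e ^+ 2 <= C.
    apply: le_trans hy; rewrite ler_wpM2l ?ler0n //.
    rewrite (bigD1 a) //=; apply: le_trans ex _; rewrite lerDl.
    by apply: sumr_ge0 => a' _; exact: sqr_ge0.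
  by rewrite leNgt hn.
rewrite -[leRHS]mul1r -x1 mulr_suml; apply: ler_sum => a _.
by have [aP|/xP ->] := boolP (a \in P); rewrite ?mul0r // ler_wpM2l ?pe.
Qed.

End Minimax.

(** * Reciprocity of the a priori metrics *)

Section Duality.
Context {R : realType} (G : game_structure R).

Local Notation S := (state G).
Local Notation M := (move G).
Implicit Types (d : S -> S -> R) (k : S -> R).

Lemma expect_payoff (s : S) (x1 x2 : M -> R) k :
  expect s x1 x2 k = payoff (fun a b => \sum_u delta s a b u * k u) x1 x2.
Proof.
rewrite /expect /payoff /delta_mixed.
under eq_bigr do rewrite mulr_suml.
rewrite exchange_big; apply: eq_bigr => a _ /=.
rewrite /pure_payoff mulr_sumr.
under eq_bigr do rewrite mulr_suml.
rewrite exchange_big; apply: eq_bigr => b _ /=.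
rewrite mulr_suml mulr_sumr; apply: eq_bigr => u _; ring.
Qed.

Lemma expect_compl (s : S) (x1 x2 : M -> R) k :
  mixed P1 s x1 -> mixed P2 s x2 ->
  expect s x1 x2 (fun u => 1 - k u) = 1 - expect s x1 x2 k.
Proof.
move=> m1 m2; have [_ d1] := delta_mixed_distr m1 m2.
rewrite /expect -[1 in RHS]d1 -sumrB; apply: eq_bigr => u _; ring.
Qed.

Lemma valuation_compl k : valuation k -> valuation (fun u => 1 - k u).
Proof. by move=> vk u; have := vk u; lra. Qed.

(** One inequality is weak duality, comparing both infima at the same pair of moves. For the other,
    [minimax] gives player 2 one move that holds the expectation of [k] to [Pre P1 k s + e] against
    every [x1]. *)
Lemma Pre_compl k (s : S) :
  valuation k -> Pre P2 (fun u => 1 - k u) s = 1 - Pre P1 k s.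
Proof.
move=> vk; have vk' := valuation_compl vk.
have b i q x : valuation q -> mixed i s x ->
    bnd1 (mixed (opponent i) s) (fun xo => expect_for i s x xo q).
  by move=> vq mx xo mxo; have := expect_for_itv mx mxo vq; lra.
have b' i q : valuation q -> bnd1 (mixed i s)
    (fun x => inf [set expect_for i s x xo q | xo in mixed (opponent i) s]).
  by move=> vq x mx; exact: bnd1_inf (mixed_neq0 _ _) (b _ _ _ vq mx).
apply/le_anti/andP; split.
  apply: sup_img_le => [|x2 m2]; first exact: mixed_neq0.
  rewrite lerBrDl -lerBrDr; apply: sup_img_le => [|x1 m1]; first exact: mixed_neq0.
  have h1 := inf_le_img (b P1 _ _ vk m1) m2.
  have h2 := inf_le_img (b P2 _ _ vk' m2) m1.
  by rewrite /= expect_compl // in h1 h2 *; lra.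
apply/ler_addgt0Pr => e e0; have e2 : 0 < e / 2 by lra.
(* One half of [e] pays for an answer to [x1] that is only near the infimum, the other is the slack
   of [minimax]. *)
have [x1 m1|x2 m2 h] := @minimax R M M (fun a b => \sum_u delta s a b u * k u)
    (Gam P1 s) (Gam P2 s) (Pre P1 k s + e / 2) (e / 2) (Gam_neq0 _ _) _ e2.
  have [x2 m2 h] := inf_img_adherent (mixed_neq0 P2 s) (b P1 _ _ vk m1) e2.
  exists x2 => //; rewrite -expect_payoff.
  have h1 := img_le_sup (b' P1 _ vk) m1.
  by rewrite /= -/(Pre P1 k s) in h h1; lra.
have h1 := img_le_sup (b' P2 _ vk') m2.
rewrite /= -/(Pre P2 _ s) in h1.
suff : 1 - Pre P1 k s - e <=
    inf [set expect s xo x2 (fun u => 1 - k u) | xo in mixed P1 s] by lra.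
have [x0 mx0] := mixed_neq0 P1 s.
apply: lb_le_inf => [|_ [x1 m1 <-]]; first by eexists; exists x0.
by rewrite expect_compl // expect_payoff; have := h _ m1; lra.
Qed.

Lemma Cval_compl d k : Cval d k -> Cval (dconv d) (fun u => 1 - k u).
Proof.
move=> [vk kd]; split=> [|s t]; first exact: valuation_compl.
by rewrite /dconv; have := kd t s; lra.
Qed.

Lemma dconvK d : dconv (dconv d) = d.
Proof. by []. Qed.

Lemma obs_distC (s t : S) : obs_dist s t = obs_dist t s.
Proof. by apply: eq_bigr => v _; rewrite distrC. Qed.

Lemma H_prio_dconv d : H_prio P2 (dconv d) = dconv (H_prio P1 d).
Proof.
apply/funext => t; apply/funext => s; rewrite /dconv /H_prio obs_distC.
congr (Num.max _ (sup _)); apply/seteqP; split=> _ [k kd <-].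
  exists (fun u => 1 - k u); first exact: (@Cval_compl (dconv d)).
  have := Pre_compl s (valuation_compl kd.1).
  have := Pre_compl t (valuation_compl kd.1).
  have -> : (fun u => 1 - (1 - k u)) = k by apply/funext => u; ring.
  by move=> -> ->; ring.
exists (fun u => 1 - k u); first exact: Cval_compl.
by rewrite !Pre_compl; [ring|exact: kd.1..].
Qed.

Lemma directed_metric_dconv d : directed_metric d -> directed_metric (dconv d).
Proof.
move=> [d0 dr dt]; split=> [s t|s|s t u]; rewrite /dconv //.
by rewrite addrC.
Qed.

(** The involution [dconv] carries fixpoints of either operator to fixpoints of the other; the two
    minimality properties give the two inequalities. *)
Lemma is_lfp_dconv (F F' : (S -> S -> R) -> (S -> S -> R)) d d' :
  (forall e, F' (dconv e) = dconv (F e)) ->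
  is_lfp F d -> is_lfp F' d' -> d' = dconv d.
Proof.
move=> FF' [dd Fd dmin] [dd' Fd' dmin'].
apply/funext => s; apply/funext => t; apply/le_anti/andP; split.
  apply: dmin'; first exact: directed_metric_dconv.
  by rewrite FF' Fd.
apply: (dmin (dconv d')); first exact: directed_metric_dconv.
by rewrite -[LHS]dconvK -FF' dconvK Fd'.
Qed.

Lemma sim_prio_reciprocal : sim_prio (G := G) P2 = dconv (sim_prio (G := G) P1).
Proof.
exact: is_lfp_dconv H_prio_dconv (is_lfp_sim_prio G P1) (is_lfp_sim_prio G P2).
Qed.

Lemma bisim_prio_reciprocal : bisim_prio (G := G) P1 = bisim_prio (G := G) P2.
Proof.
have symF e : symmetrize (H_prio P2) (dconv e) =
    dconv (symmetrize (@H_prio R G P1) e).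
  by rewrite /symmetrize H_prio_dconv.
rewrite (is_lfp_dconv symF (is_lfp_bisim_prio G P1) (is_lfp_bisim_prio G P2)).
(* It remains that the metric equals its converse; unfolding the fixpoint once shows it as a maximum
   symmetric in the two states. *)
have [_ <- _] := is_lfp_bisim_prio G P1.
by apply/funext => s; apply/funext => t; exact: maxC.
Qed.

End Duality.

(** * Bounds on [H_post] by strategies *)

Section PostBounds.
Context {R : realType} (G : game_structure R) (i : player).
Context (d : state G -> state G -> R) (dd : directed_metric d).
Context (s t : state G).

Local Notation E4 x y yo xo :=
  (fun k => expect_for i s x xo k - expect_for i t y yo k).

Let bE x y yo xo : mixed i s x -> mixed i t y ->
  mixed (opponent i) t yo -> mixed (opponent i) s xo ->
  bnd1 (Cval d) (E4 x y yo xo).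
Proof.
move=> mx my myo mxo k [vk _].
by have := expect_for_itv mx mxo vk; have := expect_for_itv my myo vk; lra.
Qed.

Let K x y yo xo := sup [set E4 x y yo xo k | k in Cval d].
Let L1 x y yo := inf [set K x y yo xo | xo in mixed (opponent i) s].
Let L2 x y := sup [set L1 x y yo | yo in mixed (opponent i) t].
Let L3 x := inf [set L2 x y | y in mixed i t].

Let bK x y yo : mixed i s x -> mixed i t y -> mixed (opponent i) t yo ->
  bnd1 (mixed (opponent i) s) (K x y yo).
Proof.
by move=> mx my myo xo mxo; exact: bnd1_sup (Cval_neq0 dd) (bE mx my myo mxo).
Qed.

Let b1 x y : mixed i s x -> mixed i t y ->
  bnd1 (mixed (opponent i) t) (L1 x y).
Proof. by move=> mx my yo myo; exact: bnd1_inf (mixed_neq0 _ _) (bK mx my myo). Qed.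

Let b2 x : mixed i s x -> bnd1 (mixed i t) (L2 x).
Proof. by move=> mx y my; exact: bnd1_sup (mixed_neq0 _ _) (b1 mx my). Qed.

Let b3 : bnd1 (mixed i s) L3.
Proof. by move=> x mx; exact: bnd1_inf (mixed_neq0 _ _) (b2 mx). Qed.

(** Each infimum is bounded by its value at a witness, which may depend on all outer choices, and
    each supremum by all its values. In [le_H_post] the roles are exchanged. *)
Lemma H_post_le (c : R) : obs_dist s t <= c ->
  (forall x, mixed i s x -> exists2 y, mixed i t y &
     forall yo, mixed (opponent i) t yo -> exists2 xo, mixed (opponent i) s xo &
     forall k, Cval d k -> expect_for i s x xo k - expect_for i t y yo k <= c) ->
  H_post i d s t <= c.
Proof.
move=> oc h; rewrite /H_post ge_max oc /=.
apply: sup_img_le => [|x mx]; first exact: mixed_neq0.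
have [y my {}h] := h x mx; apply: le_trans (inf_le_img (b2 mx) my) _.
apply: sup_img_le => [|yo myo]; first exact: mixed_neq0.
have [xo mxo {}h] := h yo myo; apply: le_trans (inf_le_img (bK mx my myo) mxo) _.
by apply: sup_img_le; first exact: Cval_neq0.
Qed.

Lemma le_H_post (c : R) x : mixed i s x ->
  (forall y, mixed i t y -> exists2 yo, mixed (opponent i) t yo &
     forall xo, mixed (opponent i) s xo -> exists2 k, Cval d k &
     c <= expect_for i s x xo k - expect_for i t y yo k) ->
  c <= H_post i d s t.
Proof.
move=> mx h; rewrite /H_post le_max; apply/orP; right.
apply: le_trans (img_le_sup b3 mx).
have [y0 my0] := mixed_neq0 i t.
apply: lb_le_inf => [|_ [y my <-]]; first by eexists; exists y0.
have [yo myo {}h] := h y my; apply: le_trans (img_le_sup (b1 mx my) myo).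
have [xo0 mxo0] := mixed_neq0 (opponent i) s.
apply: lb_le_inf => [|_ [xo mxo <-]]; first by eexists; exists xo0.
by have [k kd {}h] := h xo mxo; exact: le_trans h (img_le_sup (bE mx my myo mxo) kd).
Qed.

End PostBounds.

(** * Failure of reciprocity for the a posteriori metrics *)

Section Counterexample.
Context {R : realType}.

(* [inl false] and [inl true] are the compared states s and t; they move to
   [inr true] with probability 1/2, respectively (a1 + 2 a2) / 3, and to
   [inr false] otherwise. Transitions from [inr _] are irrelevant. *)
Definition cex_prob (s : bool + bool) (a1 a2 : bool) : R :=
  if s is inl true then (a1%:R + 2 * a2%:R) / 3 else 1 / 2.

Definition cex_delta (s : bool + bool) (a1 a2 : bool) (u : bool + bool) : R :=
  match u with
  | inl _ => 0
  | inr b => if b then cex_prob s a1 a2 else 1 - cex_prob s a1 a2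
  end.

Definition cex_interp (v : unit) (u : bool + bool) : R :=
  (u == inr true)%:R.

Lemma cex_interp_itv v u : 0 <= cex_interp v u <= 1.
Proof. by rewrite ler0n lern1 leq_b1. Qed.

Lemma cex_delta_distr s a1 a2 : is_distr (cex_delta s a1 a2).
Proof.
split=> [[u|u] //=|].
  by case: s a1 a2 u => [[]|s] [] [] [] /=; lra.
by rewrite big_sumType !big_bool /=; ring.
Qed.

Lemma cex_Gam_neq0 (i : player) (s : bool + bool) : [set: bool]%SET != finset.set0.
Proof. by apply/set0Pn; exists true. Qed.

Definition cex : game_structure R :=
  GameStructure cex_interp_itv cex_Gam_neq0 cex_delta_distr.

Definition cex_s : state cex := inl false.
Definition cex_t : state cex := inl true.

(** Both moves are available everywhere, so these are all the mixed moves and a single real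
    parameter describes each. *)
Definition bern (p : R) (b : bool) : R := if b then p else 1 - p.

Lemma mixed_bern i (s : state cex) (p : R) : 0 <= p <= 1 -> mixed i s (bern p).
Proof.
move=> p01; split; last by move=> a; rewrite inE.
split=> [[]|]; rewrite ?big_bool /=; lra.
Qed.

Lemma mixed_bernE i (s : state cex) (x : move cex -> R) :
  mixed i s x -> 0 <= x true <= 1 /\ x = bern (x true).
Proof.
move=> [[x0 x1] _]; move: x1; rewrite big_bool /= => x1.
have := x0 true; have := x0 false; split; first lra.
by apply/funext => -[] //=; lra.
Qed.

Lemma expect_cex_s (p q : R) (k : state cex -> R) :
  expect cex_s (bern p) (bern q) k = (k (inr true) + k (inr false)) / 2.
Proof.
rewrite /expect /delta_mixed big_sumType /= !big_bool /=.
by field.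
Qed.

Lemma expect_cex_t (p q : R) (k : state cex -> R) :
  expect cex_t (bern p) (bern q) k =
  k (inr false) + (p + 2 * q) / 3 * (k (inr true) - k (inr false)).
Proof.
rewrite /expect /delta_mixed big_sumType /= !big_bool /=.
by field.
Qed.

Lemma obs_dist_cex : obs_dist cex_s cex_t = 0 /\ obs_dist cex_t cex_s = 0.
Proof.
by split; apply/le_anti; rewrite obs_dist_ge0 andbT;
  apply: bigmax_le => // v _; rewrite /= /cex_interp /= subrr normr0.
Qed.

(** Dominating [obs_dist] puts the goal indicator and its complement in [Cval d], so a deviation
    from 1/2 is detected on either side. *)
Lemma le_H_post_cex d : directed_metric d -> dle (@obs_dist R cex) d ->
  1 / 3 <= H_post P1 d cex_s cex_t.
Proof.
move=> dd od.
have kd (u w : state cex) : `|cex_interp tt u - cex_interp tt w| <= d u w.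
  apply: le_trans (od u w).
  exact: (le_bigmax _ (fun v : obs cex => `|interp v u - interp v w|)).
have C1 : Cval d (cex_interp tt).
  split=> [u|u w]; first exact: cex_interp_itv.
  exact: le_trans (ler_norm _) (kd u w).
have C2 : Cval d (fun u => 1 - cex_interp tt u).
  split=> [u|u w]; first by have := cex_interp_itv tt u; lra.
  by have := kd u w; rewrite ler_norml; lra.
have h0 : 0 <= (0 : R) <= 1 by lra.
have h1 : 0 <= (1 : R) <= 1 by lra.
apply: (le_H_post dd (mixed_bern P1 cex_s h0)) => y /mixed_bernE[y01 ->].
(* Player 2 pushes to the side that player 1 favours: the goal probability from [t] becomes at least
   5/6 or at most 1/6. *)
have [yh|yh] := leP (1 / 2) (y true).
  exists (bern 1); first exact: mixed_bern.
  move=> xo /mixed_bernE[_ ->]; exists (fun u => 1 - cex_interp tt u) => //.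
  by rewrite /= expect_cex_s expect_cex_t /cex_interp /=; lra.
exists (bern 0); first exact: mixed_bern.
move=> xo /mixed_bernE[_ ->]; exists (cex_interp tt) => //.
by rewrite /= expect_cex_s expect_cex_t /cex_interp /=; lra.
Qed.

(** Both strategies make the goal probability from [t] equal to [(1 + z) / 3] with [z] in the unit
    interval, hence within 1/6 of 1/2; a valuation with values in the unit interval cannot enlarge
    that gap. *)
Lemma H_post_cex_le d : directed_metric d ->
  H_post P2 d cex_s cex_t <= 1 / 6 /\ H_post P2 d cex_t cex_s <= 1 / 6.
Proof.
move=> dd; have [o1 o2] := obs_dist_cex.
have h12 : 0 <= (1 / 2 : R) <= 1 by lra.
split; apply: H_post_le => //; rewrite ?o1 ?o2; [lra| |lra|].
  move=> x /mixed_bernE[_ ->]; exists (bern (1 / 2)); first exact: mixed_bern.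
  move=> yo /mixed_bernE[y01 ->]; exists (bern (1 / 2)); first exact: mixed_bern.
  move=> k [vk _]; rewrite /= expect_cex_s expect_cex_t.
  by have := vk (inr true); have := vk (inr false); nra.
move=> x /mixed_bernE[x01 ->]; exists (bern (1 / 2)); first exact: mixed_bern.
(* Player 1 moves at [t] knowing [x], and [(1 - x) + 2 x = 1 + x]. *)
move=> yo /mixed_bernE[_ ->]; exists (bern (1 - x true)).
  by apply: mixed_bern; lra.
move=> k [vk _]; rewrite /= expect_cex_s expect_cex_t.
by have := vk (inr true); have := vk (inr false); nra.
Qed.

Lemma sim_post_not_reciprocal :
  sim_post P1 cex_s cex_t <> sim_post P2 cex_t cex_s.
Proof.
have [d1 e1 _] := is_lfp_sim_post cex P1.
have [d2 e2 _] := is_lfp_sim_post cex P2.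
have /(le_H_post_cex d1) : dle (@obs_dist R cex) (sim_post P1).
  by move=> u w; rewrite -e1 /H_post le_max lexx.
have [_] := H_post_cex_le d2.
by rewrite e1 e2 {e1 e2} => h1 h2 h; lra.
Qed.

(** Serves the symmetrized operators: player 1 needs a lower bound in one direction only, player 2
    upper bounds in both. *)
Lemma max_neq_of_lt (a b a' b' c c' : R) :
  c <= a -> a' <= c' -> b' <= c' -> c' < c -> Num.max a b <> Num.max a' b'.
Proof.
move=> ca a'c' b'c' c'c e; have : Num.max a' b' <= c' by rewrite ge_max a'c' b'c'.
by rewrite -e ge_max => /andP[]; lra.
Qed.

Lemma bisim_post_not_reciprocal :
  bisim_post P1 cex_s cex_t <> bisim_post P2 cex_s cex_t.
Proof.
have [d1 e1 _] := is_lfp_bisim_post cex P1.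
have [d2 e2 _] := is_lfp_bisim_post cex P2.
have /(le_H_post_cex d1) h1 : dle (@obs_dist R cex) (bisim_post P1).
  move=> u w; rewrite -e1 /symmetrize /djoin le_max; apply/orP; left.
  by rewrite /H_post le_max lexx.
have [h2 h3] := H_post_cex_le d2.
rewrite -e1 -e2 /symmetrize /djoin /dconv.
by apply: max_neq_of_lt h1 h2 h3 _; clear; lra.
Qed.

End Counterexample.

Theorem theorem3p8 (R : realType) :
  (forall G : game_structure R,
     (forall s t : state G, sim_prio P1 s t = sim_prio P2 t s) /\
     bisim_prio (G := G) P1 = bisim_prio (G := G) P2) /\
  (exists (G : game_structure R) (s t : state G),
     sim_post P1 s t <> sim_post P2 t s) /\
  (exists (G : game_structure R) (s t : state G),
     bisim_post P1 s t <> bisim_post P2 s t).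
Proof.
split=> [G|]; first split=> [s t|].
- by rewrite sim_prio_reciprocal.
- exact: bisim_prio_reciprocal.
- split; exists cex, cex_s, cex_t.
    exact: sim_post_not_reciprocal.
  exact: bisim_post_not_reciprocal.
Qed.
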